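(* Let $n\ge 2$, let $P=P_n$ be the path graph on $n$ vertices, and let $S_P$ be a burning sequence of $P$ whose burning map $\lambda_P$ is a burning homomorphism. Then $$\left\lceil \frac{\sqrt{4n-3}-1}{2}\right\rceil\le |S_P|\le \left\lceil \frac n3\right\rceil,$$ where $|S_P|$ is the number of burning sources (the length of $S_P$). Moreover, for every $n\ge 2$ both equalities can be attained: there is a burning sequence of $P_n$ defining a burning homomorphism for which the left inequality is an equality, and there is a burning sequence of $P_n$ defining a burning homomorphism for which the right inequality is an equality.
   Context: The path graph $P_n$ has vertices $1,\dots,n$ and edges $\{i,i+1\}$, $1\le i\le n-1$. All graphs are finite, simple and undirected, with non-empty vertex set. $d_G(v,w)$ is the usual graph distance. For a vertex $v$ of a graph $G$ and an integer $r\ge 0$, $N_r(v)$ is the induced subgraph of $G$ on $\{w : d_G(v,w)\le r\}$. Let $S_G=(v_1,\dots,v_k)$, $k\ge 1$, be a sequence of distinct vertices of $G$. For $1\le j\le k$ let $\mathcal N_j$ be the induced subgraph of $G$ whose vertex set is the union of the vertex sets of $N_{j-i}(v_i)$, $1\le i\le j$. For $2\le j\le k+1$ let $U_j$ be the induced subgraph of $G$ whose vertex set is the union of the vertex sets of $N_{j-i}(v_i)$, $1\le i\le j-1$. The sequence $S_G$ is a burning sequence of $G$ (and the $v_i$ are its burning sources) if $v_j\notin U_j$ for $2\le j\le k$ and $U_{k+1}=G$. Put $\mathcal N_{k+1}=G$. The burning map of $S_G$ is the function $\lambda_G(v)=\min\{i : 1\le i\le k+1,\ v\in\mathcal N_i\}$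 on vertices. Let $\mathbf T$ be the maximal value of $\lambda_G$ (the end time). It is known that $\lambda_G$ maps the vertices onto $\{1,\dots,\mathbf T\}$ with $\mathbf T\in\{k,k+1\}$ and that $|\lambda_G(v)-\lambda_G(w)|\le 1$ for adjacent $v,w$. The burning map is called a burning homomorphism if it is a graph homomorphism $G\to P_{\mathbf T}$, i.e. $|\lambda_G(v)-\lambda_G(w)|=1$ for all adjacent $v,w$. *)

(* Defs.v *)
From mathcomp Require Import all_boot.

Set Implicit Arguments.
Unset Strict Implicit.
Unset Printing Implicit Defensive.

(* The empty graph is not excluded; it has no burning sequence, since a
   burning sequence has at least one source. *)
Record sgraph := SGraph {
  vertex :> finType;
  adj : rel vertex;
  adj_sym : symmetric adj;
  adj_irrefl : irreflexive adj }.

Definition graph_hom (G H : sgraph) (f : G -> H) : Prop :=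
  forall v w : G, adj v w -> adj (f v) (f w).

(* The vertices of P_n are numbered from 0: the ordinal i stands for the
   vertex i + 1. *)
Definition path_adj (n : nat) : rel 'I_n :=
  fun i j => (i.+1 == j :> nat) || (j.+1 == i :> nat).

Fact path_adj_sym (n : nat) : symmetric (@path_adj n).
Proof. by move=> i j; rewrite /path_adj orbC. Qed.

Fact path_adj_irrefl (n : nat) : irreflexive (@path_adj n).
Proof. by move=> i; rewrite /path_adj orbb (gtn_eqF (ltnSn i)). Qed.

Definition path_graph (n : nat) : sgraph :=
  SGraph (@path_adj_sym n) (@path_adj_irrefl n).

Section Burning.
Variable G : sgraph.

Definition has_walk (v w : G) (m : nat) : bool :=
  [exists p : m.-tuple G, path (@adj G) v p && (last v p == w)].

(* The least length of a walk from v to w.  Connected vertices are joined by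
   a walk of length less than #|G|, so the search range is large enough; for
   disconnected vertices the value is the dummy #|G|. *)
Definition gdist (v w : G) : nat := find (has_walk v w) (iota 0 #|G|).

(* The test [connect] accounts for infinite distances. *)
Definition ball (r : nat) (v : G) : {set G} :=
  [set w | connect (@adj G) v w && (gdist v w <= r)].

(* An induced subgraph is represented by its vertex set.  The sources
   v_1, ..., v_k are indexed from 0, v_(i+1) being [tnth S i], whereas the
   times j below are numbered from 1. *)
Section Sequence.
Variables (k : nat) (S : k.-tuple G).

Definition burned (j : nat) : {set G} :=
  if j <= k then \bigcup_(i < k | i.+1 <= j) ball (j - i.+1) (tnth S i)
  else [set: G].

Definition spread (j : nat) : {set G} :=
  \bigcup_(i < k | i.+1 <= j.-1) ball (j - i.+1) (tnth S i).

Definition burning_sequence : Prop :=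
  [/\ 0 < k,
      uniq S,
      forall j : 'I_k, 0 < j -> tnth S j \notin spread j.+1
    & spread k.+1 = [set: G]].

(* The minimum ranges over 1 <= i <= k + 1; the default k + 1 is always
   admissible because [burned k.+1] is the whole vertex set. *)
Definition burning_map (v : G) : nat :=
  [arg min_(i < (ord_max : 'I_k.+2) | (0 < i) && (v \in burned i)) (i : nat)].

Definition end_time : nat := \max_(v : G) burning_map v.

(* The shift by one reflects the numbering of the vertices of [path_graph]. *)
Definition burning_homomorphism : Prop :=
  exists2 f : G -> path_graph end_time,
    forall v : G, burning_map v = (nat_of_ord (f v)).+1 & graph_hom f.

End Sequence.
End Burning.

(* Main.v *)
Require Import Defs.
From mathcomp Require Import all_boot all_order all_algebra.
From mathcomp Require Import reals zify lra.
Import Order.TTheory GRing.Theory Num.Theory.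

(** On a path a burning sequence is a list of integer positions
    [s 0, ..., s (k - 1)], and the burning map at [x] is one more than
    [min_i (i + |x - s i|)].  Each term of this minimum changes by exactly 1
    from [x] to [x + 1], so the burning map is a homomorphism precisely when its
    parity alternates along the path, that is, when all the numbers [i + s i]
    have the same parity.  Together with the condition that no source is burned
    before its turn and the condition that everything is burned at time [k + 1],
    this turns the problem into one about integers: [burning_hom_zigzag] says
    that the burning sequences with a homomorphic burning map are the position
    lists satisfying [zigzag].  The graph of the burning map is then a zigzag
    line with its local minima at the sources.

    Fewest sources.  Neighbours never burn simultaneously, so at each edge the
    fire of some source crosses the edge from one end to the other within the
    available time.  The fire of source [i] runs for [k - i] steps in each of
    two directions, hence there are at most [2 (k + (k - 1) + ... + 1)] edges
    and [n <= k^2 + k + 1] ([zigzag_length]).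

    Most sources.  Two sources are at distance greater than the difference of
    their indices and of the same parity as it, so at distance at least 3
    ([zigzag_gap]); hence dividing positions by 3 is injective
    ([zigzag_sources]).

    Both bounds are sharp.  For many sources, a source is put at every third
    vertex.  For few, the source with [m] steps to run is put at [m^2], where
    its fire covers exactly the interval from [m (m - 1)] to [m (m + 1)], the
    next interval beginning at the last vertex of this one; paths
    shorter than [k^2 + k + 1] are obtained by cutting off the right end, and if
    that would remove the first source, by moving this source to the left and
    cutting off one vertex at the left end ([few_sources_zigzag]). *)

Set Implicit Arguments.
Unset Strict Implicit.
Unset Printing Implicit Defensive.

(** * Distances and balls in paths *)

Lemma path_adjE n (v w : 'I_n) : path_adj v w = (`|v - w|%N == 1).
Proof. rewrite /path_adj; lia. Qed.

Lemma has_walkP (G : sgraph) (v w : G) m :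
  reflect (exists p : seq G, [/\ size p = m, path (@adj G) v p & last v p = w])
          (has_walk v w m).
Proof.
apply: (iffP existsP) => [[p /andP[pP /eqP pw]]|[p [sp pP pw]]].
  by exists p; rewrite size_tuple.
by exists (Tuple (introT eqP sp)); rewrite /= pP pw eqxx.
Qed.

Lemma dist_walk n (v : path_graph n) (p : seq (path_graph n)) :
  path (@adj (path_graph n)) v p -> `|v - last v p|%N <= size p.
Proof.
elim: p v => [|w p IHp] v /=; first lia.
rewrite path_adjE => /andP[/eqP vw /IHp wl].
by apply: leq_trans (leqD_dist v w _) _; rewrite vw add1n ltnS.
Qed.

(** A shortest walk is built one step towards its end at a time. *)
Lemma walk_dist n (v w : path_graph n) : has_walk v w `|v - w|%N.
Proof.
apply/has_walkP; move Dd: (`|v - w|%N) => d.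
elim: d v Dd => [|d IHd] v Dd.
  by exists [::]; split=> //=; apply: val_inj => /=; lia.
pose u := if v < w then v.+1 else v.-1.
have u_lt : u < n.
  by rewrite /u; have := ltn_ord v; have := ltn_ord w; case: ifP; lia.
have [|p [sp pP pw]] := IHd (Ordinal u_lt).
  by rewrite /= /u; case: ifP; lia.
exists (Ordinal u_lt :: p); split => //=; first by rewrite sp.
rewrite pP andbT path_adjE /= /u.
by case: ifP; lia.
Qed.

(** The graph distance is the difference of positions: no walk is shorter by
    [dist_walk], and one of that length exists by [walk_dist].  If the search
    in [gdist] failed, its default [#|G| = n] would still exceed every
    difference of positions. *)
Lemma in_ball n r (v w : path_graph n) : (w \in ball r v) = (`|v - w|%N <= r).
Proof.
have ltvw : `|v - w|%N < #|path_graph n|.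
  by rewrite card_ord; have := ltn_ord v; have := ltn_ord w; lia.
rewrite inE; apply/andP/idP => [[_ gr]|vwr].
  apply: leq_trans gr; rewrite /gdist.
  have [hw|/hasNfind->] := boolP (has (has_walk v w) (iota 0 #|path_graph n|));
    last by rewrite size_iota ltnW.
  have lt_find : find (has_walk v w) (iota 0 #|path_graph n|) < #|path_graph n|.
    by rewrite -[X in _ < X](size_iota 0) -has_find.
  have := nth_find 0 hw; rewrite nth_iota // add0n.
  by case/has_walkP => p [sp pP pw]; rewrite -sp -{1}pw dist_walk.
split.
  by have /has_walkP[p [_ pP pw]] := walk_dist v w; apply/connectP; exists p.
apply: leq_trans vwr; rewrite leqNgt; apply/negP => /(before_find 0).
by rewrite nth_iota // add0n walk_dist.
Qed.

(** * Burning homomorphisms as integer sequences *)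

(** Naming the position keeps the ambient type of [tnth] out of sight of
    integer arithmetic. *)
Definition source_pos n k (S : k.-tuple (path_graph n)) (i : 'I_k) : nat :=
  tnth S i.

(** With times counted from 0, the fire of source [i] arrives at [x] at time
    [i + `|x - s i|].  The three conditions say that no source burns before its
    turn, that the arrival times of the different fires at a vertex agree modulo
    2, and that some fire reaches every vertex by time [k]. *)
Definition zigzag n k (s : 'I_k -> nat) : Prop :=
  [/\ forall i j : 'I_k, i < j -> j < i + `|s i - s j|%N,
      forall i j : 'I_k, odd (i + s i) = odd (j + s j)
    & forall x, x < n -> exists i : 'I_k, i + `|x - s i|%N <= k].

Lemma in_spread n k (S : k.-tuple (path_graph n)) (v : path_graph n) j :
  reflect (exists2 i : 'I_k, i < j & i + `|v - source_pos S i|%N <= j)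
          (v \in spread S j.+1).
Proof.
apply: (iffP bigcupP) => [[i /= ij]|[i ij vi]].
  by rewrite in_ball subSS distnC -/(source_pos S i) => vi; exists i => //; lia.
by exists i => //; rewrite in_ball subSS distnC -/(source_pos S i); lia.
Qed.

Lemma in_burned n k (S : k.-tuple (path_graph n)) (v : path_graph n) j :
  j < k ->
  reflect (exists i : 'I_k, i + `|v - source_pos S i|%N <= j)
          (v \in burned S j.+1).
Proof.
move=> jk; rewrite /burned jk.
apply: (iffP bigcupP) => [[i /= ij]|[i vi]].
  by rewrite in_ball subSS distnC -/(source_pos S i) => vi; exists i => //; lia.
by exists i; [lia | rewrite in_ball subSS distnC -/(source_pos S i); lia].
Qed.

Lemma spread_cover n k (S : k.-tuple (path_graph n)) :
  spread S k.+1 = [set: path_graph n] <->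
  forall v : path_graph n, exists i : 'I_k, i + `|v - source_pos S i|%N <= k.
Proof.
split=> [sT v|cov]; last first.
  apply/setP => v; rewrite inE; apply/in_spread.
  by have [i vi] := cov v; exists i; rewrite ?ltn_ord.
have: v \in spread S k.+1 by rewrite sT inE.
by case/in_spread => i _ vi; exists i.
Qed.

(** The burning map is one more than the minimal arrival time.  Its default
    value [k + 1] agrees with this, because some fire arrives everywhere by time
    [k]. *)
Lemma burning_mapP n k (S : k.-tuple (path_graph n)) :
    (forall v : path_graph n,
       exists i : 'I_k, i + `|v - source_pos S i|%N <= k) ->
  forall v : path_graph n,
  (exists i : 'I_k, burning_map S v = (i + `|v - source_pos S i|%N).+1) /\
  forall i : 'I_k, burning_map S v <= (i + `|v - source_pos S i|%N).+1.
Proof.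
move=> cov v; rewrite /burning_map.
case: arg_minnP => [|/= j /andP[j_gt0 vj] jmin].
  by rewrite /= /burned ltnn inE.
have jle (i : 'I_k) : j <= (i + `|v - source_pos S i|%N).+1.
  have [lt_k|] := ltnP (i + `|v - source_pos S i|%N) k; last first.
    by have := ltn_ord j; lia.
  have lt2 : (i + `|v - source_pos S i|%N).+1 < k.+2 by rewrite !ltnS ltnW.
  by apply: (jmin (Ordinal lt2)) => /=; apply/in_burned => //; exists i.
split=> //.
have [i vi] : exists i : 'I_k, i + `|v - source_pos S i|%N <= j.-1.
  have [ljk|lkj] := leqP j k.
    by apply/in_burned; rewrite prednK.
  by have [i vi] := cov v; exists i; lia.
by exists i; have := jle i; lia.
Qed.

(** The target path is long enough by the definition of [end_time], so being a
    homomorphism is only a matter of differences. *)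
Lemma burning_map_adj n k (S : k.-tuple (path_graph n)) :
  burning_homomorphism S <->
  forall v w : path_graph n, `|v - w|%N = 1 ->
    `|burning_map S v - burning_map S w|%N = 1.
Proof.
split=> [[f fE fhom] v w vw|map1].
  have : adj v w by rewrite /= path_adjE vw.
  by move=> /fhom; rewrite /= path_adjE !fE => /eqP; lia.
have map_gt0 v : 0 < burning_map S v.
  rewrite /burning_map; case: arg_minnP => [|j /andP[]] //.
  by rewrite /= /burned ltnn inE.
have lt_end v : (burning_map S v).-1 < end_time S.
  by rewrite prednK // /end_time (leq_bigmax v).
exists (fun v => Ordinal (lt_end v) : path_graph (end_time S)) => [v|v w].
  by rewrite /= prednK.
rewrite /= !path_adjE /= => /eqP /map1; have := map_gt0 v; have := map_gt0 w.
lia.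
Qed.

Lemma burning_map_source n k (S : k.-tuple (path_graph n)) (j : 'I_k) :
  burning_sequence S -> burning_map S (tnth S j) = j.+1.
Proof.
case=> _ _ sep /spread_cover cov.
have [[i ->] /(_ j)] := burning_mapP cov (tnth S j).
rewrite -/(source_pos S j) distnn addn0 => ub.
(* An earlier fire arriving by time [j] would have burned the source before. *)
have [ij|] := ltnP i j; last by lia.
by have := sep j (leq_ltn_trans (leq0n i) ij); case/in_spread; exists i.
Qed.

(** From left to right, the burning map alternates in parity along the path
    and takes the value [j + 1] at source [j], whence the parity condition.
    From right to left, the burning map changes by at most 1 along an edge since
    each arrival time does, and by the parity condition it does change. *)
Lemma burning_hom_zigzag n k (S : k.-tuple (path_graph n)) :
  burning_sequence S /\ burning_homomorphism S <->
  0 < k /\ zigzag n (source_pos S).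
Proof.
split=> [[bS /burning_map_adj hS]|[k_gt0 [sep par cov']]].
  have [k_gt0 _ sep /spread_cover cov] := bS; split=> //; split.
  - move=> i j ij; rewrite ltnNge; apply/negP => le_j.
    have := sep j (leq_ltn_trans (leq0n i) ij).
    case/in_spread; exists i => //.
    rewrite -/(source_pos S j) distnC; lia.
  - have par (v w : path_graph n) :
        odd (burning_map S v + v) = odd (burning_map S w + w).
      wlog vw : v w / v <= w => [hw|].
        by have [/hw //|/ltnW /hw] := leqP v w.
      case: w vw => w ltw; elim: w ltw => [|w IHw] ltw /= vw.
        by congr (odd (burning_map S _ + _)); [apply: val_inj => /=; lia | lia].
      move: vw; rewrite leq_eqVlt => /predU1P[vw|vw].
        by congr (odd (burning_map S _ + _)); first apply: val_inj.
      rewrite (IHw (ltnW ltw)) //=.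
      have := hS (Ordinal (ltnW ltw)) (Ordinal ltw); rewrite /=.
      lia.
    move=> i j; have := par (tnth S i) (tnth S j).
    rewrite !burning_map_source // /source_pos !addSn /=.
    lia.
  - by move=> x ltx; have [i] := cov (Ordinal ltx); exists i.
have cov (v : path_graph n) : exists i : 'I_k, i + `|v - source_pos S i|%N <= k.
  exact: cov'.
split; first split=> //.
- apply/tuple_uniqP => i j eqij; apply: val_inj.
  have eqp : source_pos S i = source_pos S j by rewrite /source_pos eqij.
  by have [lt_ij|lt_ij|//] := ltngtP i j;
    have := sep _ _ lt_ij; rewrite eqp distnn; lia.
- move=> j _; apply/in_spread => -[i /sep ij].
  rewrite -/(source_pos S j); lia.
- exact/spread_cover.
apply/burning_map_adj => v w vw.
have [[i vi] vle] := burning_mapP cov v.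
have [[j wj] wle] := burning_mapP cov w.
have := vle j; have := wle i; have := par i j; rewrite vi wj; lia.
Qed.

Lemma zigzag_burning n k (s : 'I_k -> nat) :
    0 < k -> (forall i, s i < n) -> zigzag n s ->
  exists S : k.-tuple (path_graph n),
    burning_sequence S /\ burning_homomorphism S.
Proof.
move=> k_gt0 lt_sn [sep par cov].
pose S : k.-tuple (path_graph n) := [tuple Ordinal (lt_sn i) | i < k].
have sE i : source_pos S i = s i by rewrite /source_pos tnth_mktuple.
exists S; apply/burning_hom_zigzag; split=> //.
split=> [i j|i j|x /cov[i]]; rewrite ?sE; [exact: sep|exact: par|].
by exists i; rewrite sE.
Qed.

(** * Bounds on the number of sources *)

Lemma sum_interval a b N : \sum_(x < N) (a <= x < b) = minn N b - a.
Proof.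
by elim: N => [|N IHN]; rewrite ?big_ord0 ?big_ord_recr /= ?IHN; lia.
Qed.

Lemma sum_double_countdown k : \sum_(i < k) (k - i).*2 = k * k.+1.
Proof.
elim: k => [|k IHk]; first by rewrite big_ord0.
rewrite big_ord_recl (eq_bigr (fun i : 'I_k => (k - i).*2)) // IHk subn0; nia.
Qed.

(** The fire of some source crosses the edge from [x] to [x + 1] by time [k]:
    take a source whose fire reaches [x] by then, or, if it gets there only at
    time [k], one whose fire reaches [x + 1], by parity before time [k]. *)
Lemma zigzag_edge n k (s : 'I_k -> nat) x :
    zigzag n s -> x.+1 < n ->
  exists i : 'I_k, s i - (k - i) <= x < s i + (k - i).
Proof.
move=> [_ par cov] ltx.
have [i xi] := cov x (ltnW ltx); have [j xj] := cov x.+1 ltx.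
have [|le_ki] := ltnP (i + `|x - s i|%N) k; first by exists i; lia.
by exists j; have := par i j; lia.
Qed.

(** Counting the edges by the sources whose fires cross them: source [i]
    crosses at most [2 (k - i)] of them. *)
Lemma zigzag_length n k (s : 'I_k -> nat) : zigzag n s -> n <= (k * k + k).+1.
Proof.
move=> zs; case: n zs => [//|N] zs.
rewrite ltnS -mulnSr -sum_double_countdown -[N]card_ord -sum1_card.
apply: (@leq_trans (\sum_(x < N) \sum_(i < k)
                      (s i - (k - i) <= x < s i + (k - i)))).
  apply: leq_sum => x _.
  have [|i xi] := zigzag_edge (x := x) zs; first by rewrite ltnS.
  by rewrite (bigD1 i) //= xi.
by rewrite exchange_big leq_sum // => i _; rewrite sum_interval; lia.
Qed.

(** The distance exceeds the difference of the indices, which is at least 1,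
    and has the same parity. *)
Lemma zigzag_gap n k (s : 'I_k -> nat) (i j : 'I_k) :
  zigzag n s -> i != j -> 3 <= `|s i - s j|%N.
Proof.
move=> [sep par _] /eqP nij.
have {}nij : i <> j :> nat by move=> /val_inj.
have := par i j; have [lt_ij|lt_ij|//] := ltngtP i j;
  have := sep _ _ lt_ij; lia.
Qed.

Lemma zigzag_sources n k (s : 'I_k -> nat) :
  (forall i, s i < n) -> zigzag n s -> k <= (n + 2) %/ 3.
Proof.
move=> lt_sn zs.
have lt3 i : s i %/ 3 < (n + 2) %/ 3 by have := lt_sn i; lia.
rewrite -[k]card_ord -[X in _ <= X]card_ord.
apply: (@leq_card _ _ (fun i => Ordinal (lt3 i))) => i j /(congr1 val) /= eq3.
by apply/eqP/negPn/negP => /(zigzag_gap zs); lia.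
Qed.

(** * Sequences with many sources *)

(** The burning map is [1, 2, 3, 2, 3, 4, 3, ...] from the first source on.
    When 3 divides [n], the last vertex would be two steps away from the last
    source and burn too late; shifting all sources by one cures this. *)
Lemma many_sources_zigzag n k (s : 'I_k -> nat) :
    k = (n + 2) %/ 3 -> (forall i : 'I_k, s i = 3 * i + (3 %| n)) ->
  (forall i, s i < n) /\ zigzag n s.
Proof.
move=> Dk sE; split=> [i|]; first by rewrite sE; have := ltn_ord i; lia.
split=> [i j|i j|x ltx]; rewrite ?sE; try lia.
have ltq : (x - (3 %| n)) %/ 3 < k by lia.
by exists (Ordinal ltq); rewrite sE /=; lia.
Qed.

Lemma many_sources n : 0 < n ->
  exists S : ((n + 2) %/ 3).-tuple (path_graph n),
    burning_sequence S /\ burning_homomorphism S.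
Proof.
move=> n_gt0.
have [//|lts zs] :=
  @many_sources_zigzag n _ (fun i => 3 * i + (3 %| n)) erefl.
by apply: zigzag_burning lts zs; lia.
Qed.

(** * Sequences with few sources *)

(** Consecutive intervals from [m (m - 1)] to [m (m + 1)] share an endpoint, so
    they leave no gap. *)
Lemma pronic_between k y :
  y < k * k.-1 -> exists2 m, 0 < m < k & m * m.-1 <= y <= m * m.+1.
Proof.
elim: k => [|k IHk] //= lty.
have [/IHk[m /andP[m_gt0 ltm] ym]|ley] := ltnP y (k * k.-1).
  by exists m => //; lia.
by exists k; nia.
Qed.

(** With [k = j + m], source [j] at [m^2] is out of reach at time [j] of a fire
    lit at time 0 beyond [k (k - 1)]. *)
Lemma sqr_le_pronic j m : 0 < j -> 0 < m -> j + m * m <= (j + m) * (j + m).-1.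
Proof. by case: j m => [|j] [|m] // _ _; rewrite addSn /=; nia. Qed.

(** Sources at [(m + d)^2] and [m^2] have indices differing by [d] only. *)
Lemma sqr_gap m d : 0 < m -> 0 < d -> m * m + d < (m + d) * (m + d).
Proof. by case: m d => [|m] [|d] // _ _; nia. Qed.

(** The source with [m = k - i] steps to run sits at [m^2 - a], where [a] is the
    number of vertices cut off at the left end; only the first source, with
    [m = k], has an adjustable position [p].  The upper bounds on [p] and [n]
    let the first fire meet the others and reach the right end; the lower bound
    on [p] keeps the first source out of reach of the other fires, which end at
    [k (k - 1) - a]. *)
Lemma few_sources_zigzag n k a p (s : 'I_k -> nat) :
    a <= 1 -> p < n -> n <= (p + k).+1 -> p + a <= k * k -> k * k.-1 < p + a ->
    odd p = odd (k + a) ->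
    (forall i : 'I_k,
       s i = if i == 0 :> nat then p else (k - i) * (k - i) - a) ->
  (forall i, s i < n) /\ zigzag n s.
Proof.
move=> a1 ltp len lep gep oddp sE; split=> [i|].
  rewrite sE; case: eqP => [//|i_neq0].
  have : (k - i) * (k - i) <= k * k.-1 by rewrite leq_mul //; lia.
  lia.
split=> [i j|i j|x ltx].
- rewrite !sE => lt_ij; have := ltn_ord j.
  have -> : (j == 0 :> nat) = false by lia.
  move=> ltj; have [m m_gt0 Dk] : exists2 m, 0 < m & k = j + m.
    by exists (k - j); lia.
  have kj : k - j = m by lia.
  rewrite kj; case: eqP => [i0|/eqP i0].
    have : j + m * m <= k * k.-1.
      by have := @sqr_le_pronic j m; rewrite -Dk; apply; lia.
    lia.
  have [d d_gt0 Di] : exists2 d, 0 < d & k - i = m + d by exists (j - i); lia.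
  have := sqr_gap m_gt0 d_gt0.
  have : 0 < m * m by rewrite muln_gt0 m_gt0.
  rewrite Di; lia.
- have par (l : 'I_k) : odd (l + s l) = odd (k + a).
    rewrite sE; case: eqP => [-> //|_].
    have le_a : a <= (k - l) * (k - l).
      by rewrite (leq_trans a1) // muln_gt0 !subn_gt0 ltn_ord.
    rewrite !oddD oddB // oddM andbb oddB; last exact/ltnW/ltn_ord.
    by case: (odd l) (odd k) (odd a) => [] [] [].
  by rewrite !par.
have k_gt0 : 0 < k by case: posnP lep gep => // ->; lia.
have sqk : k * k = k * k.-1 + k by rewrite -mulnSr prednK.
have [lexp|ltxp] := leqP p (x + k).
  by exists (Ordinal k_gt0); rewrite sE /=; lia.
(* To the left of the first fire, the pronic intervals take over. *)
have [|m /andP[m_gt0 ltm] xm] := @pronic_between k (x + a); first by lia.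
have lti : k - m < k by lia.
exists (Ordinal lti); rewrite sE /=.
have -> : (k - m == 0) = false by lia.
rewrite (subKn (ltnW ltm)).
have := leq_pmulr m m_gt0.
by move: xm; rewrite mulnS -subn1 mulnBr muln1; lia.
Qed.

Lemma few_sources n k : (k * k.-1).+1 < n <= (k * k + k).+1 ->
  exists S : k.-tuple (path_graph n),
    burning_sequence S /\ burning_homomorphism S.
Proof.
move=> /andP[gtn len].
have k_gt0 : 0 < k by nia.
have [a [p [a1 ltp [lenp lep gep oddp]]]] : exists a p,
    [/\ a <= 1, p < n & [/\ n <= (p + k).+1, p + a <= k * k, k * k.-1 < p + a
      & odd p = odd (k + a)]].
  (* The first source stays at [k^2] if this is a vertex; otherwise it moves to
     the last vertex, or the one before, according to parity. *)
  have [ltkn|lenk] := ltnP (k * k) n.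
    exists 0, (k * k); split=> //; split; rewrite ?addn0 ?oddM ?andbb //.
    by rewrite ltn_pmul2l // prednK.
  case: n gtn len lenk => [|[|N]] // gtn len lenk.
  have [nk|nk] := boolP (odd (N + k)).
    by exists 1, N; split=> //; split; lia.
  by exists 1, N.+1; split=> //; split; lia.
have [//|lts zs] := few_sources_zigzag a1 ltp lenp lep gep oddp
  (s := fun i => if i == 0 :> nat then p else (k - i) * (k - i) - a).
exact: zigzag_burning lts zs.
Qed.

(** * The two ceilings *)

Local Open Scope ring_scope.

(** Squaring: [sqrt (4 n - 3) <= 2 k + 1] means [n <= k^2 + k + 1]. *)
Lemma ceil_sqrt_le (R : realType) (n k : nat) : (0 < n)%N ->
  (Num.ceil ((Num.sqrt (4 * n%:R - 3) - 1) / 2 : R) <= k%:Z)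
    = (n <= (k * k + k).+1)%N.
Proof.
move=> n_gt0; rewrite ceil_le_int.
have n1 : 1 <= n%:R :> R by rewrite ler1n.
have k0 : 0 <= k%:R :> R by rewrite ler0n.
rewrite -(ler_nat R) -[(_ + _).+1]addn1 !natrD natrM -pmulrn.
rewrite ler_pdivrMr // lerBlDr -[X in _ <= X]ger0_norm; last by lra.
rewrite -sqrtr_sqr ler_sqrt ?sqr_ge0 //.
by apply/idP/idP; nra.
Qed.

Lemma ceil_third_le (R : realType) (n k : nat) :
  (Num.ceil (n%:R / 3 : R) <= k%:Z) = (n <= 3 * k)%N.
Proof.
by rewrite ceil_le_int -(ler_nat R) natrM -pmulrn ler_pdivrMr // mulrC.
Qed.

Lemma ceil_third (R : realType) (n : nat) :
  Num.ceil (n%:R / 3 : R) = ((n + 2) %/ 3)%N%:Z.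
Proof.
case: n => [|n]; first by rewrite mul0r ceil0.
have : Num.ceil (n.+1%:R / 3 : R) <= ((n.+1 + 2) %/ 3)%N%:Z.
  by rewrite ceil_third_le; lia.
have : ~~ (Num.ceil (n.+1%:R / 3 : R) <= ((n.+1 + 2) %/ 3).-1%N%:Z).
  by rewrite ceil_third_le; lia.
lia.
Qed.

Lemma ceil_sqrt (R : realType) (n : nat) : (2 <= n)%N ->
  exists2 k : nat, Num.ceil ((Num.sqrt (4 * n%:R - 3) - 1) / 2 : R) = k%:Z
    & ((k * k.-1).+1 < n <= (k * k + k).+1)%N.
Proof.
move=> n_gt1.
have [|[|k] lek kmin] := @ex_minnP (fun k => n <= (k * k + k).+1)%N.
- by exists n; nia.
- lia.
have ltk : ((k * k + k).+1 < n)%N.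
  by rewrite ltnNge; apply/negP => /kmin; rewrite ltnn.
exists k.+1; last by rewrite lek andbT /=; lia.
have := ceil_sqrt_le R k.+1 (ltnW n_gt1); rewrite lek => le_ceil.
have := ceil_sqrt_le R k (ltnW n_gt1); rewrite leqNgt ltk => gt_ceil.
lia.
Qed.

Theorem theorem5p4 (R : realType) (n : nat) (hn : (2 <= n)%N) :
  [/\ forall (k : nat) (S : k.-tuple (path_graph n)),
        burning_sequence S -> burning_homomorphism S ->
        Num.ceil ((Num.sqrt (4 * n%:R - 3) - 1) / 2 : R) <= k%:Z /\
        k%:Z <= Num.ceil (n%:R / 3 : R),
      exists (k : nat) (S : k.-tuple (path_graph n)),
        [/\ burning_sequence S, burning_homomorphism S
          & Num.ceil ((Num.sqrt (4 * n%:R - 3) - 1) / 2 : R) = k%:Z]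
    & exists (k : nat) (S : k.-tuple (path_graph n)),
        [/\ burning_sequence S, burning_homomorphism S
          & k%:Z = Num.ceil (n%:R / 3 : R)]].
Proof.
split=> [k S bS hS||].
- have [_ zS] : (0 < k)%N /\ zigzag n (source_pos S).
    by apply/burning_hom_zigzag.
  split; first by rewrite (ceil_sqrt_le R k (ltnW hn)) (zigzag_length zS).
  by rewrite ceil_third lez_nat (zigzag_sources _ zS) // => i; apply: ltn_ord.
- have [k ceilE /few_sources[S [bS hS]]] := ceil_sqrt R hn.
  by exists k, S.
- have [S [bS hS]] := many_sources (ltnW hn).
  by exists ((n + 2) %/ 3)%N, S; rewrite ceil_third.
Qed.
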